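(* Let $n\ge 2$ be an integer. (i) Suppose $n$ is not prime and let $p$ be the smallest prime divisor of $n$. Then there exists a subgroup $\mathcal{H}$ of $\mathcal{S}_n$, isomorphic to $C_p\times C_p$, such that $\mathrm{Sh}^1(\mathcal{H},A_{n-1})\cong\mathbb{Z}/p\mathbb{Z}$. (ii) If $n=2^a\ge 4$ then $\mathrm{Sh}^1(\mathcal{A}_n,A_{n-1})\cong\mathrm{Sh}^1(\mathcal{T},A_{n-1})\cong\mathbb{Z}/2\mathbb{Z}$, where $\mathcal{A}_n\le\mathcal{S}_n$ is the alternating group of degree $n$ and $\mathcal{T}$ denotes the Sylow $2$-subgroup of $\mathcal{A}_n$.
   Context: $\mathcal{S}_n$ is the symmetric group on $\{1,\ldots,n\}$ and $C_p$ is the cyclic group of order $p$. $A_{n-1}=\{(z_1,\ldots,z_n)\in\mathbb{Z}^n\mid\sum_i z_i=0\}$ with $\mathcal{S}_n$ permuting the coordinates of $\mathbb{Z}^n$; it is regarded as a module over subgroups of $\mathcal{S}_n$ by restriction. For a finite group $\mathcal{G}$ and a $\mathbb{Z}[\mathcal{G}]$-module $M$, put $$\mathrm{Sh}^i(\mathcal{G},M)=\bigcap_{g\in\mathcal{G}}\operatorname{Ker}\left(\operatorname{Res}^{\mathcal{G}}_{\langle g\rangle}:H^i(\mathcal{G},M)\to H^i(\langle g\rangle,M)\right),$$ where $\operatorname{Res}$ is restriction in group cohomology. *)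

(* Defs.v *)
From HB Require Import structures.
From mathcomp Require Import all_boot fingroup perm alt pgroup sylow.
From mathcomp Require Import morphism gproduct zmodp.
From mathcomp Require Import ssralg ssrnum ssrint matrix.
From mathcomp Require Import generic_quotient ring_quotient.
From mathcomp Require Import boolp.

Set Implicit Arguments.
Unset Strict Implicit.
Unset Printing Implicit Defensive.

Import GRing.Theory.
Local Open Scope ring_scope.

Definition zmod_iso (U V : zmodType) : Prop :=
  exists f : {additive U -> V}, bijective f.

(* A Z[G]-module, where G is all of gT, presented as an abelian group with an
   additive left action of G. *)
Record gmodule (gT : finGroupType) := GModule {
  gmodule_sort :> zmodType;
  gact : gT -> gmodule_sort -> gmodule_sort;
  gact1 : forall x, gact 1%g x = x;
  gactM : forall g h x, gact (g * h)%g x = gact g (gact h x);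
  gactB : forall g, zmod_morphism (gact g)
}.

Section Restriction.
Variables (gT : finGroupType) (M : gmodule gT) (H : {group gT}).

Definition gres_act (h : subg_of H) (x : M) : M := gact (sgval h) x.

Fact gres_act1 x : gres_act 1%g x = x. Proof. exact: gact1. Qed.
Fact gres_actM g h x : gres_act (g * h)%g x = gres_act g (gres_act h x).
Proof. exact: gactM. Qed.
Fact gres_actB g : zmod_morphism (gres_act g). Proof. exact: gactB. Qed.

Definition gres : gmodule (subg_of H) :=
  GModule gres_act1 gres_actM gres_actB.
End Restriction.

(* Inhomogeneous cochains: functions G^i -> M. *)
Notation cochain gT M i := {ffun (gT ^ i)%type -> gmodule_sort M}.

(* (g_0, .., g_i) |-> (g_0, .., g_j g_(j+1), .., g_i) *)
Definition merge (gT : finGroupType) i (j : 'I_i) (g : (gT ^ i.+1)%type) :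
    (gT ^ i)%type :=
  [ffun k : 'I_i =>
     if (k < j)%N then g (lift ord_max k)
     else if k == j then (g (lift ord_max k) * g (lift ord0 k))%g
     else g (lift ord0 k)].

Section Cohomology.
Variables (gT : finGroupType) (M : gmodule gT).

(* (df)(g_0, .., g_i) = g_0 f(g_1, .., g_i)
     + \sum_(j < i) (-1)^(j+1) f(g_0, .., g_j g_(j+1), .., g_i)
     + (-1)^(i+1) f(g_0, .., g_(i-1)) *)
Definition cobound i (f : cochain gT M i) : cochain gT M i.+1 :=
  [ffun g : (gT ^ i.+1)%type =>
     gact (g ord0) (f [ffun k => g (lift ord0 k)])
     + \sum_(j < i) f (merge j g) *~ (-1) ^+ j.+1
     + f [ffun k => g (lift ord_max k)] *~ (-1) ^+ i.+1].

Fact cobound_is_zmod_morphism i : zmod_morphism (@cobound i).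
Proof.
move=> f1 f2; apply/ffunP=> g; rewrite !ffunE gactB.
under eq_bigr do rewrite !ffunE mulrzBl.
by rewrite sumrB mulrzBl !opprD [RHS]addrACA [X in _ = X + _]addrACA.
Qed.
HB.instance Definition _ i :=
  GRing.isZmodMorphism.Build (cochain gT M i) (cochain gT M i.+1)
    (@cobound i) (@cobound_is_zmod_morphism i).

Definition cocycle_pred i : {pred cochain gT M i} := fun f => cobound f == 0.
Fact cocycle_closed i : zmod_closed (@cocycle_pred i).
Proof.
split=> [|f1 f2]; rewrite !unfold_in /cocycle_pred ?raddf0 //.
by move=> /eqP z1 /eqP z2; rewrite raddfB /= z1 z2 subr0.
Qed.
HB.instance Definition _ i :=
  GRing.isZmodClosed.Build (cochain gT M i) (@cocycle_pred i)
    (@cocycle_closed i).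

Record cocycle (i : nat) := Cocycle {
  cocycle_val : cochain gT M i;
  cocycleP : cocycle_val \in @cocycle_pred i
}.
HB.instance Definition _ i := [isSub for @cocycle_val i].
HB.instance Definition _ i := [Choice of cocycle i by <:].
HB.instance Definition _ i := [SubChoice_isSubZmodule of cocycle i by <:].

Definition is_coboundary i : cochain gT M i -> Prop :=
  match i with
  | 0 => fun f => f = 0
  | j.+1 => fun f => exists h : cochain gT M j, f = cobound h
  end.

Definition coboundary_pred i : {pred cocycle i} :=
  fun f => `[< is_coboundary (val f) >].
Fact coboundary_closed i : zmod_closed (@coboundary_pred i).
Proof.
split=> [|f1 f2]; rewrite !unfold_in /coboundary_pred.
  by apply/asboolP; case: i => [|i] //=; exists 0; rewrite raddf0.
move=> /asboolP b1 /asboolP b2; apply/asboolP; rewrite raddfB.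
case: i f1 f2 b1 b2 => [|i] f1 f2 /= => [->->|[h1 ->] [h2 ->]].
  by rewrite subr0.
by exists (h1 - h2); rewrite raddfB.
Qed.
HB.instance Definition _ i :=
  GRing.isZmodClosed.Build (cocycle i) (@coboundary_pred i)
    (@coboundary_closed i).

Definition cohom (i : nat) : zmodType := Quotient.quot (@coboundary_pred i).

Definition cohom_class i (f : cocycle i) : cohom i :=
  (\pi_(Quotient.quot (@coboundary_pred i)) f)%qT.

Fact cohom_class_is_zmod_morphism i : zmod_morphism (@cohom_class i).
Proof. exact: pi_is_zmod_morphism. Qed.
HB.instance Definition _ i :=
  GRing.isZmodMorphism.Build (cocycle i) (cohom i) (@cohom_class i)
    (@cohom_class_is_zmod_morphism i).

Lemma cohom_class_eq0 i (f : cocycle i) :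
  (cohom_class f == 0) = (f \in @coboundary_pred i).
Proof.
by rewrite -[f in RHS]subr0 (Quotient.idealrBE (@coboundary_pred i)) raddf0.
Qed.

Definition cohom_repr i (x : cohom i) : cocycle i :=
  repr (x : Quotient.quot (@coboundary_pred i)).

Lemma cohom_reprK i : cancel (@cohom_repr i) (@cohom_class i).
Proof. exact: reprK. Qed.
End Cohomology.

Section CohomRestriction.
Variables (gT : finGroupType) (M : gmodule gT) (H : {group gT}).

Definition res_cochain i (f : cochain gT M i) :
    cochain (subg_of H) (gres M H) i :=
  [ffun h : (subg_of H ^ i)%type => f [ffun k => sgval (h k)]].

Fact res_cochain_is_zmod_morphism i : zmod_morphism (@res_cochain i).
Proof. by move=> f1 f2; apply/ffunP=> h; rewrite !ffunE. Qed.
HB.instance Definition _ i :=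
  GRing.isZmodMorphism.Build (cochain gT M i)
    (cochain (subg_of H) (gres M H) i) (@res_cochain i)
    (@res_cochain_is_zmod_morphism i).

Lemma res_cobound i (f : cochain gT M i) :
  res_cochain (cobound f) = cobound (res_cochain f).
Proof.
apply/ffunP=> h; rewrite !ffunE; congr (_ + _ + _ *~ _).
- by congr (gact _ (f _)); apply/ffunP=> k; rewrite !ffunE.
- apply: eq_bigr => j _; rewrite !ffunE; congr (f _ *~ _).
  by apply/ffunP=> k; rewrite !ffunE; do 2?[case: ifP].
by congr (f _); apply/ffunP=> k; rewrite !ffunE.
Qed.

Fact res_cocycle_proof i (f : cocycle M i) :
  res_cochain (val f) \in @cocycle_pred _ (gres M H) i.
Proof.
rewrite unfold_in /cocycle_pred -res_cobound.
by have := cocycleP f; rewrite unfold_in /cocycle_pred => /eqP->; rewrite raddf0.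
Qed.
Definition res_cocycle i (f : cocycle M i) : cocycle (gres M H) i :=
  Cocycle (res_cocycle_proof f).

Fact res_cocycle_is_zmod_morphism i : zmod_morphism (@res_cocycle i).
Proof. by move=> f1 f2; apply: val_inj; rewrite /= !raddfB. Qed.
HB.instance Definition _ i :=
  GRing.isZmodMorphism.Build (cocycle M i) (cocycle (gres M H) i)
    (@res_cocycle i) (@res_cocycle_is_zmod_morphism i).

Definition cohom_res i (x : cohom M i) : cohom (gres M H) i :=
  cohom_class (res_cocycle (cohom_repr x)).

Lemma cohom_res_class i (f : cocycle M i) :
  cohom_res (cohom_class f) = cohom_class (res_cocycle f).
Proof.
apply/eqP; rewrite -subr_eq0 -!raddfB cohom_class_eq0.
have: cohom_repr (cohom_class f) - f \in @coboundary_pred _ M i.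
  by rewrite -cohom_class_eq0 raddfB /= cohom_reprK subrr.
rewrite !unfold_in /coboundary_pred; move: (_ - f) => {}f.
move=> /asboolP b; apply/asboolP; case: i f b => [|i] f /=.
  by move=> ->; rewrite raddf0.
by case=> h ->; exists (res_cochain h); rewrite res_cobound.
Qed.

Fact cohom_res_is_zmod_morphism i : zmod_morphism (@cohom_res i).
Proof.
move=> x y; rewrite -[x]cohom_reprK -[y]cohom_reprK -raddfB.
by rewrite !cohom_res_class !raddfB.
Qed.
HB.instance Definition _ i :=
  GRing.isZmodMorphism.Build (cohom M i) (cohom (gres M H) i)
    (@cohom_res i) (@cohom_res_is_zmod_morphism i).
End CohomRestriction.

Section Sha.
Variables (gT : finGroupType) (M : gmodule gT) (i : nat).

Definition Sha_pred : {pred cohom M i} :=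
  fun x => [forall g : gT, cohom_res <[g]>%G x == 0].
Fact Sha_closed : zmod_closed Sha_pred.
Proof.
split=> [|x y]; rewrite !unfold_in /Sha_pred.
  by apply/forallP=> g; rewrite raddf0.
move=> /forallP kx /forallP ky; apply/forallP=> g.
by rewrite raddfB /= (eqP (kx g)) (eqP (ky g)) subr0.
Qed.
HB.instance Definition _ :=
  GRing.isZmodClosed.Build (cohom M i) Sha_pred Sha_closed.

Record Sha := ShaElt { Sha_val : cohom M i; ShaP : Sha_val \in Sha_pred }.
HB.instance Definition _ := [isSub for Sha_val].
HB.instance Definition _ := [Choice of Sha by <:].
HB.instance Definition _ := [SubChoice_isSubZmodule of Sha by <:].
End Sha.

Section RootLattice.
Variable n : nat.

Definition Alat_pred : {pred 'rV[int]_n} := fun z => \sum_j z 0 j == 0.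
Fact Alat_closed : zmod_closed Alat_pred.
Proof.
split=> [|x y]; rewrite !unfold_in /Alat_pred.
  by rewrite big1 // => j _; rewrite mxE.
move=> /eqP x0 /eqP y0; under eq_bigr do rewrite !mxE.
by rewrite sumrB x0 y0 subr0.
Qed.
HB.instance Definition _ :=
  GRing.isZmodClosed.Build 'rV[int]_n Alat_pred Alat_closed.

(* The lattice of sum-zero vectors of Z^n; it has rank n - 1 and is usually
   written A_(n-1), but is indexed here by n. *)
Record Alat := AlatElt { Alat_val : 'rV[int]_n; AlatP : Alat_val \in Alat_pred }.
HB.instance Definition _ := [isSub for Alat_val].
HB.instance Definition _ := [Choice of Alat by <:].
HB.instance Definition _ := [SubChoice_isSubZmodule of Alat by <:].

Fact Alat_act_proof (s : 'S_n) (z : Alat) : col_perm s (val z) \in Alat_pred.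
Proof.
have /eqP z0 : \sum_j val z 0 j == 0 := AlatP z.
apply/eqP; rewrite -[RHS]z0 [RHS](reindex_inj (@perm_inj _ s)).
by apply: eq_bigr => j _; rewrite mxE.
Qed.

(* (s z)_j = z_(s j). As (s * t) j = t (s j) in 'S_n, this is a left action;
   the identification s |-> s^-1 with the group of permutations under
   functional composition turns it into (s z)_j = z_(s^-1 j). *)
Definition Alat_act (s : 'S_n) (z : Alat) : Alat := AlatElt (Alat_act_proof s z).

Fact Alat_act1 z : Alat_act 1%g z = z.
Proof. by apply: val_inj; rewrite /= col_perm1. Qed.
Fact Alat_actM s t z : Alat_act (s * t)%g z = Alat_act s (Alat_act t z).
Proof. by apply: val_inj; rewrite /= col_permM. Qed.
Fact Alat_actB s : zmod_morphism (Alat_act s).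
Proof. by move=> x y; apply: val_inj; apply/rowP=> j; rewrite /= !mxE. Qed.

Definition A_module : gmodule 'S_n := GModule Alat_act1 Alat_actM Alat_actB.
End RootLattice.

(* Main.v *)
From HB Require Import structures.
From mathcomp Require Import all_boot fingroup perm alt pgroup sylow.
From mathcomp Require Import morphism gproduct zmodp.
From mathcomp Require Import ssralg ssrnum ssrint intdiv matrix.
From mathcomp Require Import action primitive_action cyclic boolp.
Require Import Defs.

(** The exact sequence 0 -> A_(n-1) -> Z^n -> Z -> 0 of modules over a subgroup
    H of S_n, together with H^1(H, Z^n) = 0, identifies H^1(H, A_(n-1)) with the
    cokernel of the coordinate sum on the H-invariant vectors of Z^n.  An
    invariant vector is constant on each orbit, so the image of the sum is
    generated by the orbit lengths, and H^1(H, A_(n-1)) = Z/d(H) where d(H),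
    written [orbit_gcd] below, is the gcd of the orbit lengths of H.  In this
    description restriction to a subgroup K is the projection Z/d(H) -> Z/d(K),
    hence
       Sh^1(H, A_(n-1)) = L Z / d(H) Z
    where L is the lcm of the d(<h>), h in H, written [cyclic_orbit_lcm].
    This is [Sha_root_lattice]; the ingredients are [permutation_cocycle_split]
    (vanishing of H^1(H, Z^n), in terms of cocycles) and [invariant_sumP]
    (the sums of invariant vectors are the multiples of d(H)).  What remains is
    to compute d(H) and L for each of the groups concerned.

    For n composite with smallest prime divisor p, write n = m * p, so that
    p <= m.  If m = p, let C_p x C_p act regularly on p^2 points: then
    d(H) = p^2, while nontrivial elements have order p and L = p.  If m > p, let
    C_p x C_p act on m orbits of length p, each a quotient by one of the p + 1
    lines of (Z/p)^2, every line being used at least once.  Then d(H) = p, while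
    every element lies in one of the lines, thus has a fixed point, and L = 1.
    Both give Z/p.

    For n = 2^a >= 4, the alternating group and its Sylow 2-subgroup T are
    transitive, the latter because n is a power of 2 ([Sylow_transitive]), so
    d = n.  An n-cycle is odd since n is even; hence for h even d(h) is a proper
    divisor of 2^a ([even_perm_orbit_gcd]).  The value n/2 is reached by the
    square of an n-cycle, an even permutation of 2-power order, which has a
    conjugate in T.  So L = n/2 and both groups give Z/2. *)

Set Implicit Arguments.
Unset Strict Implicit.
Unset Printing Implicit Defensive.
Import GRing.Theory Num.Theory.
Local Open Scope ring_scope.

(** * Cohomology in degree one, in terms of crossed homomorphisms *)

Section H1.
Variables (gT : finGroupType) (M : gmodule gT).

Definition cochain1 (f : gT -> M) : cochain gT M 1 :=
  [ffun g : (gT ^ 1)%type => f (g ord0)].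

Definition value1 (f : cocycle M 1) (g : gT) : M := val f [ffun=> g].

Lemma ffun1E (T : Type) (g : (T ^ 1)%type) : g = [ffun=> g ord0].
Proof. by apply/ffunP => i; rewrite ffunE ord1. Qed.

Lemma cobound1E (f : cochain gT M 1) (g h : gT) :
  cobound f (finfun (fun i : 'I_2 => if i == ord0 then g else h)) =
  gact g (f [ffun=> h]) - f [ffun=> (g * h)%g] + f [ffun=> g].
Proof.
rewrite ffunE big_ord_recl big_ord0 addr0 !ffunE /=.
rewrite expr1 exprS expr1 mulrN1z mulrNN mulr1.
congr (gact _ (f _) - f _ + f _); apply/ffunP => i; by rewrite !ffunE ?ord1.
Qed.

Lemma cocycle1P (f : cochain gT M 1) :
  f \in @cocycle_pred gT M 1 <->
  forall g h, f [ffun=> (g * h)%g] = f [ffun=> g] + gact g (f [ffun=> h]).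
Proof.
rewrite unfold_in /cocycle_pred; split=> [/eqP df0 g h | fM].
  have /esym/eqP := cobound1E f g h.
  by rewrite df0 ffunE addrAC subr_eq0 addrC => /eqP <-.
apply/eqP/ffunP => k.
have -> : k = finfun (fun i : 'I_2 => if i == ord0 then k ord0 else k ord_max).
  apply/ffunP => i; rewrite ffunE; case: eqP => [-> // | /eqP i0].
  by congr (k _); apply: val_inj; case: i i0 => [[|[]]].
by rewrite cobound1E fM opprD addrCA subrr addr0 addNr ffunE.
Qed.

Lemma value1M (f : cocycle M 1) g h :
  value1 f (g * h)%g = value1 f g + gact g (value1 f h).
Proof. exact: (cocycle1P _).1 (cocycleP f) g h. Qed.

Lemma coboundary1P (f : cocycle M 1) :
  is_coboundary (val f) <-> exists w : M, forall g, value1 f g = gact g w - w.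
Proof.
split=> [[u fu] | [w fw]].
  exists (u [ffun=> 1%g]) => g.
  rewrite /value1 fu !ffunE big_ord0 addr0 mulrN1z.
  by congr (gact _ (u _) - u _); apply/ffunP => -[].
exists [ffun=> w]; apply/ffunP => g.
rewrite [g]ffun1E [LHS]fw !ffunE big_ord0 addr0 mulrN1z; congr (_ - _).
Qed.

Lemma cohom1_eq0 (f : cocycle M 1) :
  cohom_class f = 0 <-> exists w : M, forall g, value1 f g = gact g w - w.
Proof.
rewrite -coboundary1P; split=> [/eqP | fb].
  by rewrite cohom_class_eq0 => /asboolP.
by apply/eqP; rewrite cohom_class_eq0; apply/asboolP.
Qed.

End H1.

Lemma cohom1_res_eq0 (gT : finGroupType) (M : gmodule gT) (K : {group gT})
    (f : cocycle M 1) :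
  cohom_res K (cohom_class f) = 0 <->
  exists w : M, forall g, g \in K -> value1 f g = gact g w - w.
Proof.
have val_res (k : subg_of K) :
    value1 (res_cocycle K f) k = value1 f (sgval k).
  rewrite /value1 /= ffunE; congr (cocycle_val f _).
  by apply/ffunP => i; rewrite !ffunE.
rewrite cohom_res_class cohom1_eq0; split=> [] [w fw]; exists w => k.
  by move=> kK; have := fw (subg K k); rewrite val_res /= /gres_act subgK.
by rewrite val_res fw ?subgP.
Qed.

(** * Invariant vectors and cocycles of permutation modules *)

Definition orbit_gcd (aT : finGroupType) (rT : finType)
    (to : {action aT &-> rT}) (A : {set aT}) : nat :=
  \big[gcdn/0%N]_(x : rT) #|orbit to A x|.

Section InvariantSums.
Variable T : finType.
Implicit Types (K H : {group {perm T}}) (F : {perm T} -> T -> int).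

Definition invariant_sum K (s : int) : Prop :=
  exists z : T -> int, (forall g x, g \in K -> z (g x) = z x) /\ \sum_x z x = s.

Lemma invariant_sum_orbit K x : invariant_sum K #|orbit 'P K x|.
Proof.
exists (fun y => (y \in orbit 'P K x)%:R); split=> [g y gK |].
  by rewrite -[g y]/('P%act y g) (orbit_transl x (mem_orbit 'P y gK)).
rewrite -[RHS]natz -sum1_card natr_sum [RHS]big_mkcond /=.
by apply: eq_bigr => y _; case: (y \in _).
Qed.

Lemma invariant_sum_lin K a b s t :
  invariant_sum K s -> invariant_sum K t -> invariant_sum K (a * s + b * t).
Proof.
move=> [y [yK <-]] [z [zK <-]]; exists (fun x => a * y x + b * z x).
by split=> [g x gK|]; rewrite ?yK ?zK // big_split /= !mulr_sumr.
Qed.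

(** An invariant vector is constant on orbits, so its sum is a combination of
    orbit lengths; conversely the indicators of the orbits are invariant, and
    Bezout's identity produces the gcd of their sums. *)
Lemma invariant_sumP K s : invariant_sum K s <-> ((orbit_gcd 'P K)%:Z %| s)%Z.
Proof.
split=> [[z [zK <-]] | /dvdzP[k ->]].
  have acK : [acts K, on [set: T] | 'P] by apply/actsP=> g gK x; rewrite !inE.
  rewrite -(eq_bigl _ _ (in_setT (T := T))).
  rewrite (set_partition_big _ (orbit_partition acK)) /=.
  elim/big_ind: _ => [|a b|_ /imsetP[x _ ->]]; rewrite ?dvdz0 //.
    exact: rpredD.
  rewrite (eq_bigr (fun=> z x)) => [|_ /orbitP[g gK <-]]; last exact: zK.
  rewrite sumr_const -mulr_natr dvdz_mull // natz.
  exact: (biggcdn_inf x).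
have kd : invariant_sum K (orbit_gcd 'P K).
  rewrite /orbit_gcd; elim/big_ind: _ => [|a b Ka Kb|x _].
  - by exists (fun=> 0); split=> //; rewrite big1.
  - have [u [v uv]] := Bezoutz a b.
    by have := invariant_sum_lin u v Ka Kb; rewrite uv.
  - exact: invariant_sum_orbit.
by have := invariant_sum_lin k 0 kd kd; rewrite mul0r addr0.
Qed.

(** H^1(H, Z^T) = 0.  By Shapiro's lemma this group is a sum of groups
    Hom(H_r, Z) over stabilisers H_r of orbit representatives r, and these
    vanish because H_r is finite.  Explicitly, if t_x is an element of H taking
    the representative r of the orbit of x to x, then u x = F t_x r splits F:
    t_x * h and t_(h x) differ by an element of H_r, where F vanishes at r. *)
Lemma permutation_cocycle_split H F :
    {in H &, forall g h x, F (g * h)%g x = F g x + F h (g x)} ->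
  exists u : T -> int, {in H, forall h x, F h x = u (h x) - u x}.
Proof.
move=> FM.
(* r chooses a representative in each orbit. *)
have [r r_orb r_inv] : exists2 r : T -> T,
    forall x, x \in orbit 'P H (r x)
    & forall h x, h \in H -> r (h x) = r x.
  exists (fun x => odflt x [pick y in orbit 'P H x]) => [x | h x hH].
    case: pickP => [y yx | /(_ x)] /=; first by rewrite orbit_sym.
    by rewrite orbit_refl.
  have -> : orbit 'P H (h x) = orbit 'P H x.
    by apply/orbit_eqP; rewrite -[h x]/('P%act x h) mem_orbit.
  by case: pickP => [//|/(_ x)]; rewrite orbit_refl.
have [t tP] : exists t : T -> {perm T}, forall x, t x \in H /\ t x (r x) = x.
  have tP x : exists t, t \in H /\ t (r x) = x.
    by have /orbitP[t tH tx] := r_orb x; exists t.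
  exact: fin_all_exists tP.
have F1 x : F 1%g x = 0.
  have := FM 1%g 1%g (group1 H) (group1 H) x.
  rewrite mulg1 perm1 => /eqP.
  by rewrite -subr_eq0 opprD addNKr oppr_eq0 => /eqP.
have Ffix s x : s \in H -> s x = x -> F s x = 0.
  move=> sH sx.
  (* s has finite order and F is additive on its powers at a fixed point. *)
  have Fk k : F (s ^+ k)%g x = F s x *+ k.
    elim: k => [|k IHk]; first by rewrite expg0 F1.
    by rewrite expgS FM ?groupX // sx IHk mulrS.
  have /eqP := Fk #[s]%g; rewrite expg_order F1 eq_sym mulrn_eq0.
  by rewrite -[_ == 0%N]negbK -lt0n order_gt0 => /eqP.
exists (fun x => F (t x) (r x)) => h hH x.
have [txH txE] := tP x; have [thH thE] := tP (h x).
rewrite r_inv // in thE *.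
pose s := (t x * h * (t (h x))^-1)%g.
have sH : s \in H by rewrite !groupM ?groupV.
have sr : s (r x) = r x by rewrite !permM txE; apply: (canLR (permK _)).
have e : (s * t (h x) = t x * h)%g by rewrite mulgKV.
have := FM s (t (h x)) sH thH (r x).
rewrite e FM // (Ffix s) // sr add0r txE => <-.
by rewrite addrC addKr.
Qed.

End InvariantSums.

(** * Cocycles with values in the root lattice *)

Section PermutationLattice.
Variables (n : nat) (H : {group 'S_n}).
Local Notation M := (gres (A_module n) H).

Definition coord_sum (u : 'rV[int]_n) : int := \sum_j u 0 j.

Fact coord_sum_is_zmod_morphism : zmod_morphism coord_sum.
Proof. by move=> u v; rewrite -sumrB; apply: eq_bigr => j _; rewrite !mxE. Qed.
HB.instance Definition _ :=
  GRing.isZmodMorphism.Build _ _ coord_sum coord_sum_is_zmod_morphism.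

Lemma coord_sum_perm s u : coord_sum (col_perm s u) = coord_sum u.
Proof.
rewrite [RHS](reindex_inj (@perm_inj _ s)).
by apply: eq_bigr => j _; rewrite mxE.
Qed.

Fact displacement_proof (h : subg_of H) u :
  col_perm (sgval h) u - u \in @Alat_pred n.
Proof.
rewrite unfold_in /Alat_pred -/(coord_sum _) raddfB /=.
by rewrite coord_sum_perm subrr.
Qed.

Fact displacement_cocycle_proof u :
  cochain1 (fun h : subg_of H => AlatElt (displacement_proof h u) : M)
    \in @cocycle_pred _ M 1.
Proof.
apply/cocycle1P => g h; rewrite !ffunE; apply/val_inj/rowP => j.
by rewrite !mxE permM [RHS]addrC addrA subrK.
Qed.

(** A cocycle representing the image of coord_sum u under the connecting map
    Z -> H^1(H, A_(n-1)). *)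
Definition displacement_cocycle u : cocycle M 1 :=
  Cocycle (displacement_cocycle_proof u).

Fact displacement_cocycle_is_zmod_morphism : zmod_morphism displacement_cocycle.
Proof.
move=> u v; apply/val_inj/ffunP => g; rewrite !ffunE; apply/val_inj/rowP => j.
by rewrite !mxE !opprD !opprK addrACA.
Qed.
HB.instance Definition _ :=
  GRing.isZmodMorphism.Build _ _ displacement_cocycle
    displacement_cocycle_is_zmod_morphism.

Lemma value1_displacement u h :
  val (value1 (displacement_cocycle u) h) = col_perm (sgval h) u - u.
Proof. by rewrite /value1 /= !ffunE. Qed.

(** Every class comes from Z^n through the connecting map: as a cocycle with
    values in Z^n, f is the coboundary of some u. *)
Lemma cocycle_displacement (f : cocycle M 1) :
  exists u, f = displacement_cocycle u.
Proof.
pose F (h : 'S_n) j := val (value1 f (subg H h) : Alat n) 0 j.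
have [g h gH hH j | u uP] := permutation_cocycle_split (H := H) (F := F).
  rewrite /F morphM // value1M /= /gres_act /Alat_act /= !mxE subgK //.
exists (\row_j u j); apply/val_inj/ffunP => g; apply/val_inj/rowP => j.
rewrite [g]ffun1E; set k := g ord0.
rewrite -[LHS]/(val (value1 f k) 0 j).
rewrite -[RHS]/(val (value1 (displacement_cocycle _) k) 0 j).
by rewrite value1_displacement !mxE -uP ?subgP // /F sgvalK.
Qed.

(** Splitting the cocycle of u over K by a vector w of sum zero amounts to
    giving the K-invariant vector u - w, which has the same sum as u. *)
Lemma displacement_coboundaryP (K : {group subg_of H}) u :
  (exists w : M,
     forall g, g \in K -> value1 (displacement_cocycle u) g = gact g w - w)
  <-> ((orbit_gcd 'P (sgval @* K)%g)%:Z %| coord_sum u)%Z.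
Proof.
rewrite -invariant_sumP; split=> [[w uw] | [z [zK zu]]].
  exists (fun j => (u - val (w : Alat n)) 0 j).
  split=> [_ j /morphimP[g _ gK ->] |].
    have /(congr1 (fun v : Alat n => val v 0 j)) := uw g gK.
    rewrite -[LHS]/(val (value1 (displacement_cocycle _) g) 0 j).
    rewrite value1_displacement.
    rewrite !mxE => /eqP; rewrite subr_eq addrAC -addrA [X in _ == X]addrC.
    by rewrite -subr_eq => /eqP.
  rewrite -/(coord_sum _) raddfB /=.
  have /eqP -> : coord_sum (val (w : Alat n)) == 0 := AlatP w.
  by rewrite subr0.
have wP : u - \row_j z j \in @Alat_pred n.
  rewrite unfold_in /Alat_pred -/(coord_sum _) raddfB /= subr_eq0 -zu.
  by apply/eqP/eq_bigr => j _; rewrite mxE.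
exists (AlatElt wP : M) => g gK; apply/val_inj/rowP => j.
rewrite value1_displacement.
rewrite !mxE zK ?mem_morphim ?inE //.
by rewrite opprB addrA subrK.
Qed.

End PermutationLattice.

(** * The Tate-Shafarevich group of the root lattice *)

Lemma zmod_iso_sym (U V : zmodType) : zmod_iso U V -> zmod_iso V U.
Proof.
move=> [f [g fK gK]].
have gB : zmod_morphism g.
  by move=> x y; apply: (can_inj fK); rewrite raddfB !gK.
pose gA := GRing.isZmodMorphism.Build V U g gB.
pose ga : {additive V -> U} := HB.pack g gA.
by exists ga; exists f.
Qed.

Lemma zmod_iso_trans (U V W : zmodType) :
  zmod_iso U V -> zmod_iso V W -> zmod_iso U W.
Proof.
by move=> [f f_bij] [g g_bij]; exists (g \o f); exact: bij_comp.
Qed.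

Lemma intr_Zp_eq0 m (k : int) : (1 < m)%N ->
  (k%:~R == 0 :> 'Z_m) = (m%:Z %| k)%Z.
Proof.
move=> m_gt1; have nat_eq0 i : (i%:R == 0 :> 'Z_m) = (m %| i)%N.
  by rewrite -val_eqE /= val_Zp_nat.
by case: k => i; rewrite ?NegzE ?mulrNz ?oppr_eq0 nat_eq0.
Qed.

Lemma cyclic_zmod_iso (U : zmodType) (x : U) m :
    (1 < m)%N -> (forall y, exists k : int, y = x *~ k) ->
    (forall k : int, x *~ k = 0 <-> (m%:Z %| k)%Z) ->
  zmod_iso U 'Z_m.
Proof.
move=> m_gt1 /boolp.choice[c cE] x_ord.
have cP k l : (k%:~R == l%:~R :> 'Z_m) = (x *~ k == x *~ l).
  rewrite -subr_eq0 -mulrzBr intr_Zp_eq0 // -[RHS]subr_eq0 -mulrzBr.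
  by apply/idP/eqP => /x_ord.
pose f y : 'Z_m := (c y)%:~R.
have fB : zmod_morphism f.
  by move=> y z; apply/eqP; rewrite /f -mulrzBr cP mulrzBr -!cE.
pose fA := GRing.isZmodMorphism.Build U 'Z_m f fB.
pose fa : {additive U -> 'Z_m} := HB.pack f fA.
exists fa; exists (fun a : 'Z_m => x *~ (a : nat)) => [y | a] /=.
  apply/eqP; rewrite [y in _ == y]cE -cP -pmulrn.
  by rewrite natr_Zp.
by apply/eqP; rewrite -[a in _ == a]natr_Zp pmulrn cP -cE.
Qed.

Definition cyclic_orbit_lcm (aT : finGroupType) (rT : finType)
    (to : {action aT &-> rT}) (A : {set aT}) : nat :=
  \big[lcmn/1%N]_(h in A) orbit_gcd to <[h]>%g.

Section ShaLattice.
Variables (n : nat) (H : {group 'S_n}).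
Local Notation M := (gres (A_module n) H).

Lemma class_displacement_eq0 u :
  cohom_class (displacement_cocycle H u) = 0
  <-> ((orbit_gcd 'P H)%:Z %| coord_sum u)%Z.
Proof.
rewrite cohom1_eq0.
have := displacement_coboundaryP [set: subg_of H]%G u; rewrite im_sgval => <-.
by split=> -[w wP]; exists w => g *; apply: wP; rewrite ?inE.
Qed.

Lemma class_displacement_Sha u :
  cohom_class (displacement_cocycle H u) \in @Sha_pred _ M 1
  <-> ((cyclic_orbit_lcm 'P H)%:Z %| coord_sum u)%Z.
Proof.
have res0 g : cohom_res <[g]>%G (cohom_class (displacement_cocycle H u)) = 0
    <-> ((orbit_gcd 'P <[sgval g]>%g)%:Z %| coord_sum u)%Z.
  rewrite cohom1_res_eq0 (displacement_coboundaryP <[g]>%G) /=.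
  by rewrite morphim_cycle ?inE.
split=> [/forallP uS | uL].
  apply/dvdn_biglcmP => h hH; rewrite -(@subgK _ H h hH).
  exact/res0/eqP.
apply/forallP => g; apply/eqP/res0; apply: dvdz_trans uL.
by apply: (biglcmn_sup (sgval g)); rewrite ?subgP.
Qed.

(** The class of u in Z^n depends only on the sum of u modulo d(H), and lies in
    Sh^1 if and only if that sum is a multiple of L; so the class of a vector
    of sum L generates Sh^1, with order d(H)/L. *)
Theorem Sha_root_lattice m : (0 < n)%N -> (1 < m)%N ->
    orbit_gcd 'P H = (m * cyclic_orbit_lcm 'P H)%N ->
  zmod_iso (Sha M 1) 'Z_m.
Proof.
move=> n_gt0 m_gt1; set L := cyclic_orbit_lcm 'P H => dH.
pose i0 := Ordinal n_gt0.
have L_neq0 : L%:Z != 0.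
  have : (0 < orbit_gcd 'P H)%N.
    apply: (dvdn_gt0 (m := #|orbit 'P H i0|)); last exact: (biggcdn_inf i0).
    by apply/card_gt0P; exists i0; apply: orbit_refl.
  by rewrite dH muln_gt0 => /andP[_]; rewrite lt0n.
pose v : 'rV[int]_n := L%:Z *: delta_mx 0 i0.
have sum_v : coord_sum v = L.
  rewrite /coord_sum (bigD1 i0) //= big1 => [|j ji]; rewrite !mxE eqxx /=.
    by rewrite mulr1 addr0.
  by rewrite (negPf ji) mulr0.
have vS : cohom_class (displacement_cocycle H v) \in @Sha_pred _ M 1.
  by apply/class_displacement_Sha; rewrite sum_v.
pose x : Sha M 1 := ShaElt vS.
have xE k : val (x *~ k) = cohom_class (displacement_cocycle H (v *~ k)).
  by rewrite !raddfMz.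
apply: (cyclic_zmod_iso (x := x)) => // [y | k].
  have [u yu] : exists u, val y = cohom_class (displacement_cocycle H u).
    rewrite -(cohom_reprK (val y)).
    by have [u ->] := cocycle_displacement (cohom_repr (val y)); exists u.
  have := ShaP y; rewrite yu => /class_displacement_Sha/dvdzP[k uk].
  exists k; apply: val_inj; rewrite xE yu; apply/eqP.
  rewrite -subr_eq0 -!raddfB; apply/eqP/class_displacement_eq0.
  by rewrite raddfB raddfMz /= sum_v uk -mulrzr intz mulrC subrr dvdz0.
split=> [xk0 | mk].
  have : cohom_class (displacement_cocycle H (v *~ k)) = 0 by rewrite -xE xk0.
  move=> /class_displacement_eq0.
  by rewrite raddfMz /= sum_v -mulrzr intz dH PoszM mulrC dvdz_mul2r.
apply: val_inj; rewrite xE; apply/class_displacement_eq0.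
by rewrite raddfMz /= sum_v -mulrzr intz dH PoszM mulrC dvdz_mul.
Qed.

End ShaLattice.

(** * Two actions of an elementary abelian group of rank two *)

Local Open Scope group_scope.

Section ActionTransport.
Variables (gT : finGroupType) (X : finType) (to : {action gT &-> X}).

Definition rank_act (i : 'I_#|X|) (v : gT) : 'I_#|X| :=
  enum_rank (to (enum_val i) v).

Fact rank_act1 : rank_act^~ 1 =1 id.
Proof. by move=> i; rewrite /rank_act act1 enum_valK. Qed.
Fact rank_actM i : act_morph rank_act i.
Proof. by move=> g h; rewrite /rank_act enum_rankK actM. Qed.

Definition rank_action := TotalAction rank_act1 rank_actM.

Lemma orbit_gcd_rank (A : {group gT}) :
  orbit_gcd 'P (actperm rank_action @* A) = orbit_gcd to A.
Proof.
rewrite /orbit_gcd (reindex (@enum_rank X)) /=;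
  last exact/onW_bij/enum_rank_bij.
apply: eq_bigr => x _; rewrite -[RHS](card_imset _ (@enum_rank_inj X)).
congr #|pred_of_set _|; apply/setP => i; apply/orbitP/imsetP.
  move=> [_ /morphimP[v _ vA ->] <-]; exists (to x v); rewrite ?mem_orbit //=.
  by rewrite apermE actpermE /= /rank_act enum_rankK.
move=> [_ /orbitP[v vA <-] ->]; exists (actperm rank_action v).
  by rewrite mem_morphim ?inE.
by rewrite /= apermE actpermE /= /rank_act enum_rankK.
Qed.

(** [Sha_root_lattice] for a group presented by a faithful action on an
    arbitrary finite set, numbered by [enum_rank]. *)
Lemma Sha_faithful_action m : (0 < #|X|)%N -> (1 < m)%N ->
    [faithful [set: gT], on [set: X] | to] ->
    orbit_gcd to [set: gT] = (m * cyclic_orbit_lcm to [set: gT])%N ->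
  exists H : {group 'S_#|X|},
    H \isog [set: gT] /\ zmod_iso (Sha (gres (A_module #|X|) H) 1) 'Z_m.
Proof.
move=> X_gt0 m_gt1 /subsetP faith dX; pose f := actperm rank_action.
exists (f @* [set: gT])%G; split.
  rewrite isog_sym sub_isog //; apply/subsetP => v /morphpreP[_ /set1P fv].
  apply: faith; rewrite inE in_setT /=; apply/astabP => x _.
  have /permP/(_ (enum_rank x)) := fv.
  by rewrite perm1 actpermE /= /rank_act enum_rankK => /enum_rank_inj.
apply: Sha_root_lattice => //; rewrite orbit_gcd_rank dX; congr (_ * _)%N.
apply/eqP; rewrite eqn_dvd; apply/andP; split; apply/dvdn_biglcmP => v vV.
  apply: (biglcmn_sup (f v)); rewrite ?mem_morphim ?inE //.
  by rewrite -morphim_cycle ?inE // orbit_gcd_rank.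
have /morphimP[w _ wV ->] := vV.
by rewrite -morphim_cycle ?inE // orbit_gcd_rank (biglcmn_sup w) ?inE.
Qed.

End ActionTransport.

Lemma Zp_pair_order p (v : 'Z_p * 'Z_p) : (1 < p)%N -> (#[v] %| p)%N.
Proof.
move=> p_gt1; have vX k : v ^+ k = ((v.1 *+ k)%R, (v.2 *+ k)%R).
  elim: k => [//|k IHk]; rewrite expgS IHk.
  by congr (_, _); rewrite mulrS.
have p0 : p%:R = 0 :> 'Z_p by apply/eqP; rewrite pmulrn intr_Zp_eq0.
rewrite order_dvdn vX; apply/eqP.
by congr (_, _); rewrite -mulr_natr p0 mulr0.
Qed.

Lemma card_Zp_pair p : (1 < p)%N -> #|[set: 'Z_p * 'Z_p]| = (p * p)%N.
Proof. by move=> p_gt1; rewrite cardsT card_prod card_ord Zp_cast. Qed.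

(** The orbits of a subgroup in the regular representation are its cosets. *)
Lemma orbit_gcd_regular (gT : finGroupType) (A : {group gT}) :
  orbit_gcd 'R A = #|A|.
Proof.
rewrite /orbit_gcd (eq_bigr (fun=> #|A|)) => [|x _].
  apply/eqP; rewrite eqn_dvd (biggcdn_inf (1 : gT)) //=.
  by apply/dvdn_biggcdP.
by rewrite orbitR card_lcoset.
Qed.

Lemma Sha_regular p : prime p ->
  exists H : {group 'S_(p * p)},
    H \isog [set: 'Z_p * 'Z_p]
    /\ zmod_iso (Sha (gres (A_module (p * p)) H) 1) 'Z_p.
Proof.
move=> p_pr; have p_gt1 := prime_gt1 p_pr.
rewrite -(card_Zp_pair p_gt1) cardsT.
apply: (Sha_faithful_action (to := 'R%act)) => //.
- by rewrite -cardsT card_Zp_pair // muln_gt0 prime_gt0.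
- apply/subsetP => v /setIP[_ /astabP/(_ 1 (in_setT _))] /=.
  by rewrite mul1g => ->; rewrite inE.
rewrite (orbit_gcd_regular [set: _]) card_Zp_pair //; congr (_ * _)%N.
apply/eqP; rewrite eqn_dvd; apply/andP; split; last first.
  by apply/dvdn_biglcmP => v _; rewrite orbit_gcd_regular Zp_pair_order.
pose e : 'Z_p * 'Z_p := (1%R, 0%R).
apply: (biglcmn_sup e); rewrite ?inE // orbit_gcd_regular -orderE.
have /primeP[_ /(_ _ (Zp_pair_order e p_gt1))] := p_pr.
case/orP => [|/eqP -> //]; rewrite order_eq1 => /eqP/(congr1 fst) e1.
by have /eqP[] := oner_neq0 'Z_p.
Qed.

Section LinearForms.
Variables (p m : nat).
Hypotheses (p_pr : prime p) (pm : (p < m)%N).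
Implicit Types (i : 'I_m) (v : 'Z_p * 'Z_p).

(** The forms i * x + y for i < p, and x for i >= p, represent the p + 1 points
    of the projective line dual to (Z/p)^2.  The group acts on the i-th orbit
    Z/p by translation by the i-th form, so the kernel of that form fixes the
    orbit pointwise. *)
Definition line_form i v : 'Z_p :=
  if (i < p)%N then (i%:R * v.1 + v.2)%R else v.1.

Definition line_act (x : 'I_m * 'Z_p) v : 'I_m * 'Z_p :=
  (x.1, (x.2 + line_form x.1 v)%R).

Lemma line_formM i v w :
  line_form i (v * w) = (line_form i v + line_form i w)%R.
Proof. by rewrite /line_form; case: ifP => _ //=; rewrite mulrDr addrACA. Qed.

Fact line_act1 : line_act^~ 1 =1 id.
Proof.
move=> [i x]; rewrite /line_act /line_form /=.
by case: ifP; rewrite ?mulr0 !addr0.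
Qed.
Fact line_actM x : act_morph line_act x.
Proof. by move=> v w; rewrite /line_act /= line_formM addrA. Qed.
Definition line_action := TotalAction line_act1 line_actM.

(** A vector (x, y) is killed by the form of index -y/x, or by a form of index
    at least p, which exists as p < m, if x = 0. *)
Lemma line_form_zero v : exists i, line_form i v = 0%R.
Proof.
have p_gt1 := prime_gt1 p_pr.
have [v0 | v_neq0] := eqVneq v.1 0%R.
  by exists (Ordinal pm); rewrite /line_form /= ltnn.
have v_unit : v.1 \is a GRing.unit.
  rewrite -[v.1]natr_Zp unitZpE // prime_coprime //.
  apply: contra v_neq0 => pv.
  by rewrite -[v.1]natr_Zp pmulrn intr_Zp_eq0.
have [a av] : exists a : 'Z_p, (a * v.1 + v.2)%R = 0%R.
  by exists (- v.2 / v.1)%R; rewrite divrK // addNr.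
have ap : (a < p)%N by rewrite -[X in (_ < X)%N](Zp_cast p_gt1) ltn_ord.
exists (Ordinal (ltn_trans ap pm)).
by rewrite /line_form ap natr_Zp.
Qed.

Lemma line_form_onto i y : exists v, line_form i v = y.
Proof.
have [ip | pi] := boolP (i < p)%N.
  by exists (0%R, y); rewrite /line_form ip mulr0 add0r.
by exists (y, 0%R); rewrite /line_form (negPf pi).
Qed.

Lemma orbit_gcd_line : orbit_gcd line_action [set: 'Z_p * 'Z_p] = p.
Proof.
have p_gt1 := prime_gt1 p_pr.
rewrite /orbit_gcd (eq_bigr (fun=> p)) => [|[i x] _].
  apply/eqP; rewrite eqn_dvd; apply/andP; split; last exact/dvdn_biggcdP.
  by apply: (biggcdn_inf (Ordinal pm, 0%R : 'Z_p)).
transitivity #|pair i @: [set: 'Z_p]|; last first.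
  by rewrite card_imset => [|y z []//]; rewrite cardsT card_ord Zp_cast.
congr #|pred_of_set _|; apply/setP => x'.
apply/orbitP/imsetP => [[v _ <-] | [y _ ->]].
  by exists (x + line_form i v)%R.
have [v vE] := line_form_onto i (y - x).
by exists v; rewrite ?inE //= /line_act /= vE addrC subrK.
Qed.

Lemma orbit_gcd_line_cyclic v : orbit_gcd line_action <[v]> = 1%N.
Proof.
have [i iv0] := line_form_zero v.
apply/eqP; rewrite -dvdn1; apply: (biggcdn_inf (i, 0%R : 'Z_p)) => //.
have /orbit1P -> : (i, 0%R) \in 'Fix_line_action(<[v]>).
  rewrite afix_cycle ?in_setT //; apply/afix1P.
  by rewrite /= /line_act /= iv0 addr0.
by rewrite cards1.
Qed.

Lemma line_action_faithful :
  [faithful [set: 'Z_p * 'Z_p], on [set: 'I_m * 'Z_p] | line_action].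
Proof.
have m_gt0 : (0 < m)%N by apply: leq_ltn_trans pm.
apply/subsetP => v /setIP[_ /astabP vfix].
have form0 i : line_form i v = 0%R.
  by have /(congr1 snd) := vfix (i, 0%R) (in_setT _); rewrite /= add0r.
have := form0 (Ordinal pm); rewrite /line_form /= ltnn => v1.
have := form0 (Ordinal m_gt0).
rewrite /line_form /= prime_gt0 // mul0r add0r => v2.
by apply/set1P; case: v v1 v2 {vfix form0} => v1 v2 /= -> ->.
Qed.

Lemma Sha_linear_forms : exists H : {group 'S_(m * p)},
  H \isog [set: 'Z_p * 'Z_p]
  /\ zmod_iso (Sha (gres (A_module (m * p)) H) 1) 'Z_p.
Proof.
have p_gt1 := prime_gt1 p_pr.
have cardX : #|{: 'I_m * 'Z_p}| = (m * p)%N.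
  by rewrite card_prod !card_ord Zp_cast.
rewrite -cardX; apply: (Sha_faithful_action (to := line_action)) => //.
- by rewrite cardX muln_gt0 (leq_ltn_trans _ pm) ?prime_gt0.
- exact: line_action_faithful.
rewrite orbit_gcd_line /cyclic_orbit_lcm (eq_bigr (fun=> 1%N)) => [|v _].
  by rewrite big1_eq muln1.
exact: orbit_gcd_line_cyclic.
Qed.

End LinearForms.

(** The cofactor m of p = pdiv n exceeds 1, so it is at least p by minimality
    of p; equality is the regular case. *)
Lemma Sha_elementary_abelian n : (1 < n)%N -> ~~ prime n ->
  exists H : {group 'S_n},
    H \isog [set: 'Z_(pdiv n) * 'Z_(pdiv n)]
    /\ zmod_iso (Sha (gres (A_module n) H) 1) 'Z_(pdiv n).
Proof.
move=> n_gt1 n_comp; have p_pr := pdiv_prime n_gt1.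
have /dvdnP[m nE] := pdiv_dvd n.
have m_gt1 : (1 < m)%N.
  rewrite ltn_neqAle eq_sym; apply/andP; split.
    by apply: contraNneq n_comp => m1; rewrite nE m1 mul1n.
  by rewrite lt0n; apply: contraTneq n_gt1 => m0; rewrite nE m0.
have : (pdiv n <= m)%N.
  by apply: pdiv_min_dvd; rewrite // [X in _ %| X]nE dvdn_mulr.
move: (pdiv n) p_pr nE => p p_pr ->; rewrite leq_eqVlt => /predU1P[<- | pm].
  exact: Sha_regular.
exact: Sha_linear_forms.
Qed.

(** * Transitive groups of even permutations of 2-power degree *)

Lemma orbit_gcd_dvd_card (T : finType) (K : {group {perm T}}) :
  (orbit_gcd 'P K %| #|T|)%N.
Proof.
suff: invariant_sum K #|T| by move/invariant_sumP.
by exists (fun=> 1%R); split=> //; rewrite sumr_const natz.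
Qed.

Lemma orbit_gcd_transitive (T : finType) (K : {group {perm T}}) :
  [transitive K, on [set: T] | 'P] -> orbit_gcd 'P K = #|T|.
Proof.
move=> trK; apply/eqP; rewrite eqn_dvd orbit_gcd_dvd_card.
by apply/dvdn_biggcdP => x _; rewrite (atransP trK) ?inE // cardsT.
Qed.

(** A point stabiliser in G has index #|T|, a power of p, so the p-part of its
    order is that of G divided by #|T|.  The order of the stabiliser in P
    divides this p-part, hence its index in P is at least #|T|. *)
Lemma Sylow_transitive (T : finType) p k (G P : {group {perm T}}) :
    prime p -> #|T| = (p ^ k)%N -> [transitive G, on [set: T] | 'P] ->
    p.-Sylow(G) P ->
  [transitive P, on [set: T] | 'P].
Proof.
move=> p_pr cardT trG sylP.
have T_gt0 : (0 < #|T|)%N by rewrite cardT expn_gt0 prime_gt0.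
have [x _] := card_gt0P T_gt0.
apply/imsetP; exists x; first by rewrite inE.
apply/esym/eqP; rewrite eqEcard subsetT /= cardsT.
have := card_orbit_stab 'P G x.
rewrite (atransP trG) ?inE // cardsT => orbG.
have orbP := card_orbit_stab 'P P x.
have stab_le : (#|'C_P[x | 'P]| <= #|'C_G[x | 'P]|`_p)%N.
  apply: dvdn_leq; first exact: part_gt0.
  have sCPG : 'C_P[x | 'P] \subset 'C_G[x | 'P].
    by rewrite setSI // (pHall_sub sylP).
  have pC : p.-group 'C_P[x | 'P].
    by apply: pgroupS (pHall_pgroup sylP); apply: subsetIl.
  by rewrite -(part_pnat_id pC) partn_dvd // cardSg.
rewrite -(leq_pmul2r (cardG_gt0 'C_P[x | 'P])) orbP (card_Hall sylP) -orbG.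
rewrite partnM // part_pnat_id ?leq_mul2l ?stab_le ?orbT //.
by rewrite cardT pnatX pnat_id.
Qed.

(** The gcd of the cycle lengths divides 2^(k+1), and if it were 2^(k+1) then s
    would be a full cycle of even length, which is odd. *)
Lemma even_perm_orbit_gcd (T : finType) k (s : {perm T}) :
  #|T| = (2 ^ k.+1)%N -> ~~ odd_perm s -> (orbit_gcd 'P <[s]> %| 2 ^ k)%N.
Proof.
move=> cardT s_even.
have := orbit_gcd_dvd_card <[s]>; rewrite cardT => /dvdn_pfactor[] // b.
rewrite leq_eqVlt ltnS => /predU1P[-> dT | bk ->]; last exact: dvdn_exp2l.
case/negP: s_even.
have T_gt0 : (0 < #|T|)%N by rewrite cardT expn_gt0.
have full x : porbit s x = [set: T].
  apply/eqP; rewrite eqEcard subsetT cardsT porbitE cardT -dT /=.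
  apply: dvdn_leq; last exact: (biggcdn_inf x).
  by apply/card_gt0P; exists x; apply: orbit_refl.
have [x _] := card_gt0P T_gt0.
have -> : odd_perm s = odd #|T| (+) odd #|porbits s| by [].
suff -> : porbits s = [set [set: T]] by rewrite cards1 cardT oddX.
apply/setP => A; rewrite inE.
apply/imsetP/eqP => [[y _ ->] | ->]; first exact: full.
by exists x; rewrite // full.
Qed.

Lemma semiregular_orbit_gcd (T : finType) q (s : {perm T}) :
    (forall k x, (s ^+ k) x = x -> (q %| k)%N) ->
  (q %| orbit_gcd 'P <[s]>)%N.
Proof.
move=> s_free; apply/dvdn_biggcdP => x _; apply: (s_free _ x).
by rewrite -porbitE permX iter_porbit.
Qed.

Section SquaredRotation.
Variable n : nat.

Definition rotation : 'S_n := perm (@ordS_inj n).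

Lemma rotationX k (i : 'I_n) : (rotation ^+ k) i = ((i + k) %% n)%N :> nat.
Proof.
elim: k => [|k IHk]; first by rewrite perm1 addn0 modn_small.
by rewrite expgSr permM permE /= IHk -addn1 modnDml addn1 addnS.
Qed.

Lemma rotationX_fix k (i : 'I_n) : (rotation ^+ k) i = i <-> (n %| k)%N.
Proof.
rewrite -[n %| k]/(k %% n == 0)%N; split=> [fixi | /eqP k0].
  have := rotationX k i; rewrite fixi => /eqP.
  rewrite -{1}(modn_small (ltn_ord i)) -{1}[i : nat]addn0 eqn_modDl mod0n.
  by rewrite eq_sym.
by apply: val_inj; rewrite /= rotationX -modnDmr k0 addn0 modn_small.
Qed.

End SquaredRotation.

(** The square of the n-cycle has cycles of length n/2, which realises the
    largest gcd that an even permutation can have. *)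
Lemma Sha_even_2power n k (H : {group 'S_n}) :
    n = (2 ^ k.+1)%N -> H \subset 'Alt_('I_n) ->
    [transitive H, on [set: 'I_n] | 'P] ->
    (exists g, (rotation n ^+ 2) ^ g \in H) ->
  zmod_iso (Sha (gres (A_module n) H) 1) 'Z_2.
Proof.
move=> nE H_even trH [g gH].
apply: Sha_root_lattice; rewrite ?[n in (_ < n)%N]nE ?expn_gt0 //.
rewrite orbit_gcd_transitive // card_ord [LHS]nE expnS; congr (_ * _)%N.
apply/eqP; rewrite eqn_dvd; apply/andP; split.
  apply: (biglcmn_sup _ gH); apply: semiregular_orbit_gcd => i x.
  rewrite -conjXg -{1}[x](permKV g) permJ => /(canRL (permK g)).
  by rewrite -expgM => /rotationX_fix; rewrite nE expnS dvdn_pmul2l.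
apply/dvdn_biglcmP => h hH; apply: even_perm_orbit_gcd.
  by rewrite card_ord.
by have := subsetP H_even h hH; rewrite Alt_even.
Qed.

Lemma rotation2_Alt n : rotation n ^+ 2 \in 'Alt_('I_n).
Proof. by rewrite Alt_even odd_permM addbb. Qed.

Lemma Sha_Alt_and_Sylow n k (T : {group 'S_n}) :
    n = (2 ^ k.+1)%N -> (4 <= n)%N -> 2.-Sylow('Alt_('I_n)) T ->
  zmod_iso (Sha (gres (A_module n) 'Alt_('I_n)) 1) 'Z_2
  /\ zmod_iso (Sha (gres (A_module n) T) 1) 'Z_2.
Proof.
move=> nE n_ge4 sylT; pose c := rotation n ^+ 2.
have trAlt : [transitive 'Alt_('I_n), on [set: 'I_n] | 'P].
  apply: ntransitive1 (Alt_trans _); rewrite card_ord.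
  by rewrite -subn2 subn_gt0 (leq_trans _ n_ge4).
split; apply: (Sha_even_2power nE) => //.
- by exists 1; rewrite conjg1 rotation2_Alt.
- exact: pHall_sub sylT.
- by apply: Sylow_transitive trAlt sylT; rewrite // card_ord; exact: nE.
have c2 : 2.-group <[c]>.
  rewrite /pgroup -orderE.
  apply: (@pnat_dvd _ (2 ^ k.+1)); last by rewrite pnatX.
  rewrite order_dvdn; apply/eqP/permP => i.
  by rewrite perm1 -expgM; apply/rotationX_fix; rewrite -nE dvdn_mull.
have cAlt : <[c]> \subset 'Alt_('I_n) by rewrite cycle_subG rotation2_Alt.
have [g _] := Sylow_Jsub sylT cAlt c2.
by rewrite -cycleJ cycle_subG => cgT; exists g.
Qed.

Local Close Scope group_scope.
Local Close Scope ring_scope.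

Theorem proposition4p1 (n : nat) (n_ge2 : 2 <= n) :
  (~~ prime n ->
     exists H : {group 'S_n},
       (H \isog [set: 'Z_(pdiv n) * 'Z_(pdiv n)])%g
       /\ zmod_iso (Sha (gres (A_module n) H) 1) 'Z_(pdiv n))
  /\
  (forall a : nat, n = 2 ^ a -> 4 <= n ->
     forall T : {group 'S_n}, (2.-Sylow('Alt_('I_n)) T)%g ->
       zmod_iso (Sha (gres (A_module n) 'Alt_('I_n)) 1)
                (Sha (gres (A_module n) T) 1)
       /\ zmod_iso (Sha (gres (A_module n) T) 1) 'Z_2).
Proof.
split=> [n_comp | [|k] nE n_ge4 T sylT]; first exact: Sha_elementary_abelian.
  by rewrite nE in n_ge4.
have [AltZ TZ] := Sha_Alt_and_Sylow nE n_ge4 sylT.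
by split=> //; apply: zmod_iso_trans AltZ (zmod_iso_sym TZ).
Qed.
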